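(* Let $n$ be a positive integer with factorization type $F(n)=(a_1,a_2,\ldots,a_d)$. Let $X$ be a maximal clique in the divisibility relation graph $D_n$. Then $$|X| = 1+\sum_{i=1}^d a_i = 1+\Omega(n).$$
   Context: For a positive integer $n$, the divisibility relation graph $D_n$ is the simple undirected graph whose vertex set is the set of all positive divisors of $n$, in which two vertices $a\neq b$ are adjacent if and only if $a\mid b$ or $b\mid a$. Writing $n=p_1^{a_1}\cdots p_d^{a_d}$ with $p_1,\dots,p_d$ distinct primes and $1\leq a_1\leq a_2\leq\cdots\leq a_d$, the factorization type of $n$ is $F(n)=(a_1,\ldots,a_d)$, and the degree of $n$ is $\Omega(n)=\sum_{i=1}^d a_i$, the number of prime factors of $n$ counted with multiplicity. *)

(* Defs.v *)
From HB Require Import structures.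
From mathcomp Require Import all_boot.
Set Implicit Arguments.
Unset Strict Implicit.
Unset Printing Implicit Defensive.

(* For n = 0 the list [divisors n] is empty; n is meant to be positive. *)
Definition divisor_vertex (n : nat) : finType := seq_sub (divisors n).

Definition divrel (n : nat) : rel (divisor_vertex n) :=
  fun a b => (a != b) && ((val a %| val b) || (val b %| val a)).

Definition clique (T : finType) (e : rel T) : pred {set T} :=
  fun X => [forall a in X, forall b in X, (a != b) ==> e a b].

(* Maximal for inclusion, not of maximum cardinality. *)
Definition maximal_clique (T : finType) (e : rel T) (X : {set T}) : bool :=
  maxset (clique e) X.

Definition factorization_type (n : nat) : seq nat :=
  sort leq [seq logn p n | p <- primes n].

Definition Omega (n : nat) : nat := \sum_(a <- factorization_type n) a.

(* Main.v *)
(* Omega is strictly increasing along divisibility, so it is injective on a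
   clique.  On a maximal clique it takes every value k <= Omega n: otherwise
   take the elements a, b of the clique of largest Omega below k and smallest
   Omega above k, and a prime p dividing b / a; then a * p is comparable to the
   whole clique, hence belongs to it, contradicting the choice of a. *)
Require Import Defs.
From HB Require Import structures.
From mathcomp Require Import all_boot.
Set Implicit Arguments.
Unset Strict Implicit.
Unset Printing Implicit Defensive.

(** An index range that does not depend on the prime divisors of [m] lets values at different
    arguments be compared term by term. The added indices contribute nothing, since [logn p m] is 0
    unless [p] is a prime divisor of [m]. *)
Lemma Omega_widen m N : 0 < m <= N ->
  Omega m = \sum_(0 <= p < N.+1) logn p m.
Proof.
case/andP=> m_gt0 le_mN; rewrite /Omega /factorization_type.
rewrite (perm_big _ (permEl (perm_sort leq _))) big_map.
rewrite [RHS](bigID (mem (primes m))) /= [X in _ + X]big1 ?addn0; last first.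
  by move=> p; rewrite lognE mem_primes; case: ifP => // ->.
rewrite -[RHS]big_filter; apply/perm_big/uniq_perm.
- exact: primes_uniq.
- by rewrite filter_uniq // iota_uniq.
move=> p; rewrite mem_filter mem_index_iota /= ltnS.
case pm: (p \in primes m) => //=.
move: pm; rewrite mem_primes => /and3P[_ _ p_dv_m].
by rewrite (leq_trans (dvdn_leq m_gt0 p_dv_m) le_mN).
Qed.

Lemma OmegaM m n : 0 < m -> 0 < n -> Omega (m * n) = Omega m + Omega n.
Proof.
move=> m_gt0 n_gt0.
(* The bound [m * n] serves all three sums at once. *)
rewrite !(@Omega_widen _ (m * n)) ?leqnn ?muln_gt0 ?m_gt0 ?n_gt0 ?leq_pmulr
  ?leq_pmull //.
by rewrite -big_split; apply: eq_bigr => p _; rewrite /= lognM.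
Qed.

Lemma Omega1 : Omega 1 = 0.
Proof. by rewrite /Omega /factorization_type big_nil. Qed.

Lemma Omega_prime p : prime p -> Omega p = 1.
Proof.
move=> p_pr; rewrite /Omega /factorization_type primes_prime //=.
by rewrite logn_prime // eqxx big_seq1.
Qed.

Lemma Omega_dvdn m n : 0 < n -> m %| n -> Omega n = Omega m + Omega (n %/ m).
Proof.
move=> n_gt0 m_dv_n; have m_gt0 := dvdn_gt0 n_gt0 m_dv_n.
by rewrite -OmegaM ?divn_gt0 ?(dvdn_leq n_gt0) // mulnC divnK.
Qed.

Lemma leq_Omega m n : 0 < n -> m %| n -> Omega m <= Omega n.
Proof. by move=> n_gt0 /(Omega_dvdn n_gt0)->; apply: leq_addr. Qed.

Lemma Omega_eq0 n : 0 < n -> (Omega n == 0) = (n == 1).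
Proof.
move=> n_gt0; apply/idP/eqP => [|->]; last by rewrite Omega1.
apply: contraTeq => n_neq1; have n_gt1: 1 < n by rewrite ltn_neqAle eq_sym n_neq1.
rewrite -lt0n (leq_trans _ (leq_Omega n_gt0 (pdiv_dvd n))) //.
by rewrite Omega_prime ?pdiv_prime.
Qed.

Lemma dvdn_Omega_inj m n : 0 < n -> m %| n -> Omega m = Omega n -> m = n.
Proof.
move=> n_gt0 m_dv_n /eqP; have m_gt0 := dvdn_gt0 n_gt0 m_dv_n.
rewrite (Omega_dvdn n_gt0 m_dv_n) -[X in X == _]addn0 eqn_add2l eq_sym.
rewrite Omega_eq0 ?divn_gt0 ?(dvdn_leq n_gt0) // => /eqP nm1.
by rewrite -(divnK m_dv_n) nm1 mul1n.
Qed.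

Lemma divisor_vertex_gt0 n (x : divisor_vertex n) : 0 < n -> 0 < val x.
Proof.
by move=> n_gt0; have := valP x; rewrite -dvdn_divisors //; apply: dvdn_gt0.
Qed.

Lemma clique_comparable n (X : {set divisor_vertex n}) :
  clique (@divrel n) X ->
  {in X &, forall x y, (val x %| val y) || (val y %| val x)}.
Proof.
move=> /forall_inP cX x y xX yX; have /forall_inP/(_ y yX)/implyP := cX x xX.
have [->|_ /(_ isT)/andP[] //] := eqVneq x y.
by rewrite dvdnn.
Qed.

(** If divisibility went the other way, monotonicity would make the two [Omega] values equal, and
    then the two divisors coincide. *)
Lemma clique_dvdn n (X : {set divisor_vertex n}) x y :
  0 < n -> clique (@divrel n) X -> x \in X -> y \in X ->
  Omega (val x) <= Omega (val y) -> val x %| val y.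
Proof.
move=> n_gt0 cX xX yX le_xy.
have /orP[//|y_dv_x] := clique_comparable cX xX yX.
rewrite (dvdn_Omega_inj (divisor_vertex_gt0 x n_gt0) y_dv_x) //.
by apply/eqP; rewrite eqn_leq le_xy leq_Omega ?divisor_vertex_gt0.
Qed.

(** Adjoining [c] to [X] leaves a clique, so by maximality nothing new was added. *)
Lemma maximal_clique_mem n (X : {set divisor_vertex n}) c :
  0 < n -> maximal_clique (@divrel n) X -> c %| n ->
  {in X, forall x, (val x %| c) || (c %| val x)} ->
  exists2 x, x \in X & val x = c.
Proof.
move=> n_gt0 /maxsetP[cX maxX] c_dv_n cmp_c.
have c_div : c \in divisors n by rewrite -dvdn_divisors.
pose y : divisor_vertex n := SeqSub c_div.
exists y => //; rewrite -(maxX (y |: X)) ?setU11 ?subsetUr //.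
apply/forall_inP => u uyX; apply/forall_inP => v vyX; apply/implyP => neq_uv.
rewrite /divrel neq_uv /=.
case/setU1P: uyX vyX => [->|uX] /setU1P[->|vX].
- by rewrite dvdnn.
- by rewrite orbC cmp_c.
- by rewrite cmp_c.
exact: clique_comparable cX _ _ uX vX.
Qed.

Lemma maximal_clique_Omega_onto n (X : {set divisor_vertex n}) k :
  0 < n -> maximal_clique (@divrel n) X -> k <= Omega n ->
  exists2 x, x \in X & Omega (val x) = k.
Proof.
move=> n_gt0 maxX le_kn; have /maxsetP[cX _] := maxX.
(* The divisors 1 and [n] are comparable to every vertex; they will witness that [below] and [above]
   are inhabited. *)
have [x1 x1X x1E] : exists2 x, x \in X & val x = 1.
  by apply: maximal_clique_mem => // x _; rewrite dvd1n orbT.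
have [xn xnX xnE] : exists2 x, x \in X & val x = n.
  apply: maximal_clique_mem => // x _.
  by have := valP x; rewrite -dvdn_divisors // => ->.
case: (pickP [pred x in X | Omega (val x) == k]) => [x /andP[xX /eqP xk]|no_k].
  by exists x.
have neq_k x : x \in X -> Omega (val x) != k.
  by move=> xX; move: (no_k x); rewrite /= xX /= => ->.
pose below := [pred x in X | Omega (val x) < k].
pose above := [pred x in X | k < Omega (val x)].
have x1_below : below x1.
  by rewrite /= x1X x1E Omega1 lt0n eq_sym -Omega1 -x1E neq_k.
have xn_above : above xn.
  by rewrite /= xnX xnE ltn_neqAle le_kn eq_sym -xnE neq_k.
case: (arg_maxnP (fun x => Omega (val x)) x1_below) => a /andP[aX lt_ak] max_a.
case: (arg_minnP (fun x => Omega (val x)) xn_above) => b /andP[bX lt_kb] min_b.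
have a_gt0 := divisor_vertex_gt0 a n_gt0.
have b_gt0 := divisor_vertex_gt0 b n_gt0.
have a_dv_b : val a %| val b.
  by apply: (clique_dvdn n_gt0 cX) => //; rewrite ltnW // (ltn_trans lt_ak).
set q := val b %/ val a.
have q_gt1 : 1 < q.
  have q_gt0 : 0 < q by rewrite divn_gt0 // dvdn_leq.
  (* [Omega q] is the gap between the values at [a] and [b], which lie strictly on either side of
     [k]. *)
  rewrite ltn_neqAle eq_sym q_gt0 andbT -Omega_eq0 // -lt0n.
  by rewrite -(ltn_add2l (Omega (val a))) addn0 -Omega_dvdn // (ltn_trans lt_ak).
have p_pr := pdiv_prime q_gt1.
pose c := val a * pdiv q.
have c_dv_b : c %| val b by rewrite -(divnK a_dv_b) mulnC dvdn_mul ?pdiv_dvd.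
have b_dv_n : val b %| n by have := valP b; rewrite -dvdn_divisors.
have [x xX xE] : exists2 x, x \in X & val x = c.
  apply: maximal_clique_mem => // [|x xX]; first exact: dvdn_trans b_dv_n.
  (* By the choice of [a] and [b], an element below level [k] divides [a], hence [c], and one above
     is a multiple of [b], hence of [c]. *)
  case: (ltngtP (Omega (val x)) k) => [lt_xk|lt_kx|/eqP]; last first.
  - by rewrite (negPf (neq_k x xX)).
  - rewrite (dvdn_trans c_dv_b) ?orbT // (clique_dvdn n_gt0 cX) // min_b //=.
    by rewrite xX.
  - rewrite dvdn_mulr // (clique_dvdn n_gt0 cX) //.
    by apply: max_a; rewrite /= xX.
have Oc : Omega (val x) = (Omega (val a)).+1.
  by rewrite xE [LHS]OmegaM ?pdiv_gt0 // (Omega_prime p_pr) addn1.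
(* One step up from [a] reaches at most [k], and the value [k] is not attained. *)
have x_below : below x by rewrite /= xX ltn_neqAle neq_k // Oc.
by have := max_a x x_below; rewrite /geq /= Oc ltnn.
Qed.

(** [Omega] restricts to a bijection from [X] onto the levels 0 to [Omega n], whence the
    successor. *)
Lemma card_maximal_clique n (X : {set divisor_vertex n}) :
  0 < n -> maximal_clique (@divrel n) X -> #|X| = (Omega n).+1.
Proof.
move=> n_gt0 maxX; have /maxsetP[cX _] := maxX.
have le_Omega (x : divisor_vertex n) : Omega (val x) < (Omega n).+1.
  by rewrite ltnS leq_Omega //; have := valP x; rewrite -dvdn_divisors.
pose f x : 'I_(Omega n).+1 := Ordinal (le_Omega x).
have f_inj : {in X &, injective f}.
  move=> x y xX yX /(congr1 val) /= eq_xy; apply: val_inj.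
  apply/eqP; rewrite eqn_dvd.
  (* Equal levels give divisibility in both directions. *)
  by rewrite !(clique_dvdn n_gt0 cX) // eq_xy.
rewrite -(card_in_imset f_inj) -[RHS]card_ord -cardsT; congr #|pred_of_set _|.
apply/setP => k; rewrite inE; apply/imsetP.
have [|x xX xk] := @maximal_clique_Omega_onto n X k n_gt0 maxX.
  by rewrite -ltnS.
by exists x => //; apply: val_inj.
Qed.

Theorem proposition2p15 (n d : nat) (a : d.-tuple nat)
    (n_gt0 : 0 < n) (Fn : factorization_type n = a :> seq nat)
    (X : {set divisor_vertex n}) (maxX : maximal_clique (@divrel n) X) :
  #|X| = 1 + \sum_(i < d) tnth a i /\ 1 + \sum_(i < d) tnth a i = 1 + Omega n.
Proof.
have -> : \sum_(i < d) tnth a i = Omega n by rewrite /Omega Fn big_tuple.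
by rewrite (card_maximal_clique n_gt0 maxX).
Qed.
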